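(* Let $R$ be a real closed field and $C=R[i]$ with $i^2=-1$. Let $\Gamma\subset C$ be a rectangle and let $F\in C[Z]$ be a polynomial that does not vanish at any of the four vertices of $\Gamma$. Then the algebraic winding number $w(F|\partial\Gamma)$ equals the number of roots of $F$ in $\Gamma$, where each root in the interior of $\Gamma$ is counted with its multiplicity and each root in an (open) edge of $\Gamma$ is counted with half its multiplicity.
   Context: Real closed: an ordered field $R$ is real closed if whenever $P\in R[X]$ and $a<b$ in $R$ satisfy $P(a)P(b)<0$, there is $x\in R$ with $a<x<b$ and $P(x)=0$. $C=R[i]$ is identified with $R^2$ via $(x,y)\mapsto x+iy$; for $P\in C[X]$, $\operatorname{re}P,\operatorname{im}P\in R[X]$ are the polynomials with $P=\operatorname{re}P+i\operatorname{im}P$. Cauchy index: let $f\in R(X)$, $f\ne0$, $a\in R$, and write $f=(X-a)^m g$ with $m\in\mathbb{Z}$ and $g$ having neither zero nor pole at $a$. If $m\ge0$ put $\operatorname{Ind}_a^{+}(f)=\operatorname{Ind}_a^{-}(f)=0$. If $m<0$ put $\operatorname{Ind}_a^{+}(f)=\frac12\operatorname{sign}g(a)$ and $\operatorname{Ind}_a^{-}(f)=\frac12(-1)^m\operatorname{sign}g(a)$. Let $\operatorname{Ind}_x(f)=\operatorname{Ind}_x^+(f)-\operatorname{Ind}_x^-(f)$. For $a<b$, $\operatorname{Ind}_a^b(f)=\operatorname{Ind}_a^+(f)+\sum_{a<x<b}\operatorname{Ind}_x(f)-\operatorname{Ind}_b^-(f)$. By convention $\operatorname{Ind}_a^b(\frac{U}{V})=0$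 if $U=0$ or $V=0$. Winding number: a piecewise polynomial path $\gamma\colon[0,1]\to C$ is given by polynomials $P_k\in C[X]$ on the intervals $[t_{k-1},t_k]$ of a subdivision $0=t_0<\dots<t_n=1$ (with $P_k(t_k)=P_{k+1}(t_k)$), and $w(\gamma)=\frac12\sum_k\operatorname{Ind}_{t_{k-1}}^{t_k}\bigl(\frac{\operatorname{re}P_k}{\operatorname{im}P_k}\bigr)$, which is independent of the subdivision. Rectangle: $\Gamma=[x_0,x_1]\times[y_0,y_1]$ with $x_0<x_1$, $y_0<y_1$ in $R$; vertices $(x_0,y_0),(x_1,y_0),(x_1,y_1),(x_0,y_1)$; edges are the open segments between consecutive vertices. $w(F|\partial\Gamma):=w(F\circ\gamma)$ where $\gamma$ interpolates linearly between $\gamma(0)=(x_0,y_0)$, $\gamma(\frac14)=(x_1,y_0)$, $\gamma(\frac12)=(x_1,y_1)$, $\gamma(\frac34)=(x_0,y_1)$, $\gamma(1)=(x_0,y_0)$. *)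

(* Defs.v *)
From mathcomp Require Import all_boot all_order all_algebra.
From mathcomp Require Import polyrcf complex.

Set Implicit Arguments.
Unset Strict Implicit.
Unset Printing Implicit Defensive.

Import Order.TTheory GRing.Theory Num.Theory.

Local Open Scope ring_scope.
Local Open Scope complex_scope.

Notation "p %:F" := (FracField.tofrac p) : ring_scope.

Section RationalFunctions.

Variable R : rcfType.
Implicit Types (f : {fraction {poly R}}) (a b : R) (U V : {poly R}).

Definition fnum f : {poly R} := \n_(repr f).
Definition fden f : {poly R} := \d_(repr f).

(* For f != 0, the exponent m in f = (X - a)^m g; [frac_ordP] below shows that
   this and [frac_lead] do not depend on the numerator and denominator. *)
Definition frac_ord f a : int := (mup a (fnum f))%:Z - (mup a (fden f))%:Z.

Definition cofactor_at a U : R := (U %/ ('X - a%:P) ^+ mup a U).[a].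

(* The value g(a) in f = (X - a)^m g. *)
Definition frac_lead f a : R :=
  cofactor_at a (fnum f) / cofactor_at a (fden f).

Definition ind_right f a : rat :=
  if (f == 0) || (0 <= frac_ord f a) then 0
  else (sgz (frac_lead f a))%:~R / 2.

Definition ind_left f a : rat :=
  if (f == 0) || (0 <= frac_ord f a) then 0
  else (-1) ^ frac_ord f a * (sgz (frac_lead f a))%:~R / 2.

Definition ind_at f a : rat := ind_right f a - ind_left f a.

(* The sum over all x in ]a, b[ is restricted to the zeros of a denominator of
   f, since [ind_at f x] vanishes unless x is a pole. If U = 0 or V = 0 then
   U%:F / V%:F = 0, as inversion in a field maps 0 to 0, and the index of 0
   is 0. *)
Definition cauchy_index a b f : rat :=
  ind_right f a + \sum_(x <- roots (fden f) a b) ind_at f x - ind_left f b.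

Lemma fden_neq0 f : fden f != 0.
Proof. exact: denom_ratioP. Qed.

Lemma frac_fnumden f : f = (fnum f)%:F / (fden f)%:F.
Proof.
apply/(canRL (mulfK _)); first by rewrite tofrac_eq0 fden_neq0.
rewrite /fnum /fden -{1}[f]reprK; move: (repr f) => x.
apply/eqP; rewrite -[_ * _]/(FracField.mul _ _) !piE FracField.equivfE.
by rewrite /FracField.mulf !numden_Ratio ?mulf_neq0 ?oner_eq0 ?denom_ratioP
  // !mulr1 mulrC.
Qed.

Lemma cofactorE a U : U != 0 ->
  exists2 U0, U0.[a] = cofactor_at a U & U = U0 * ('X - a%:P) ^+ mup a U.
Proof.
move=> U0; exists (U %/ ('X - a%:P) ^+ mup a U); first by [].
by rewrite divpK // -mup_geq.
Qed.

Lemma cofactor_neq0 a U : U != 0 -> cofactor_at a U != 0.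
Proof.
move=> Un0; have [U0 <- e] := cofactorE a Un0; apply/negP => r0.
have : ~~ (('X - a%:P) ^+ (mup a U).+1 %| U) by rewrite -mup_leq.
by rewrite {2}e exprS dvdp_mul // dvdp_XsubCl.
Qed.

Lemma cofactor_mulX a U n :
  U.[a] != 0 -> cofactor_at a (U * ('X - a%:P) ^+ n) = U.[a].
Proof.
move=> Ua; rewrite /cofactor_at mupMr // mup_XsubCX eqxx mulpK //.
by rewrite expf_neq0 // polyXsubC_eq0.
Qed.

Lemma cofactorM a U V : U != 0 -> V != 0 ->
  cofactor_at a (U * V) = cofactor_at a U * cofactor_at a V.
Proof.
move=> Un0 Vn0; have hU := cofactor_neq0 a Un0; have hV := cofactor_neq0 a Vn0.
have [U0 eU dU] := cofactorE a Un0; have [V0 eV dV] := cofactorE a Vn0.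
rewrite {1}dU {1}dV mulrACA -exprD cofactor_mulX hornerM eU eV //.
exact: mulf_neq0.
Qed.

Lemma frac_ordP f a (m : int) U V : U.[a] != 0 -> V.[a] != 0 ->
  f = ('X - a%:P)%:F ^ m * (U%:F / V%:F) ->
  frac_ord f a = m /\ frac_lead f a = U.[a] / V.[a].
Proof.
move=> Ua Va ef.
have Un0 : U != 0 by apply: contraNneq Ua => ->; rewrite horner0.
have Vn0 : V != 0 by apply: contraNneq Va => ->; rewrite horner0.
have Xn0 n : ('X - a%:P) ^+ n != 0 by rewrite expf_neq0 // polyXsubC_eq0.
have XF0 : ('X - a%:P)%:F != 0 by rewrite tofrac_eq0 polyXsubC_eq0.
have [p [n [em hX]]] : exists p n : nat, m = p%:Z - n%:Z /\
    ('X - a%:P)%:F ^ m = (('X - a%:P) ^+ p)%:F / (('X - a%:P) ^+ n)%:F.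
  case: m {ef} => k.
    by exists k, 0%N; rewrite subr0 expr0 tofrac1 divr1 tofracXn.
  by exists 0%N, k.+1; rewrite sub0r expr0 tofrac1 div1r tofracXn NegzE.
have dn0 := fden_neq0 f.
have e : fnum f * (V * ('X - a%:P) ^+ n) = (U * ('X - a%:P) ^+ p) * fden f.
  have dF0 : (fden f)%:F != 0 by rewrite tofrac_eq0.
  have VF0 : (V * ('X - a%:P) ^+ n)%:F != 0 by rewrite tofrac_eq0 mulf_neq0.
  have ed : (fnum f)%:F / (fden f)%:F
      = (U * ('X - a%:P) ^+ p)%:F / (V * ('X - a%:P) ^+ n)%:F.
    by rewrite -frac_fnumden ef hX mulrC mulf_div (tofracM U) (tofracM V).
  move/eqP: ed; rewrite (eqr_div _ _ dF0 VF0) -(tofracM (fnum f)).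
  by rewrite -(tofracM (U * _)) tofrac_eq => /eqP.
have nn0 : fnum f != 0.
  apply/negP => /eqP n0; move/eqP: e; rewrite n0 mul0r eq_sym.
  by rewrite !mulf_eq0 (negPf Un0) (negPf (Xn0 p)) (negPf dn0).
have := congr1 (mup a) e; have := congr1 (cofactor_at a) e.
rewrite !(cofactorM, mupM) ?mulf_neq0 // !mup_XsubCX eqxx.
rewrite !(@mupNroot _ a U, @mupNroot _ a V) // !add0n.
have cof0 W : W.[a] != 0 -> cofactor_at a W = W.[a].
  by move=> Wa; rewrite -{1}[W]mulr1 -(expr0 ('X - a%:P)) cofactor_mulX.
have cofX k : cofactor_at a (('X - a%:P) ^+ k) = 1.
  by rewrite -[X in cofactor_at a X]mul1r cofactor_mulX hornerE ?oner_eq0.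
rewrite !cofX !mulr1 (cof0 U) // (cof0 V) // => ec eo; split.
  rewrite /frac_ord em; apply/eqP.
  by rewrite subr_eq addrAC eq_sym subr_eq -!PoszD eqz_nat eo.
by apply/eqP; rewrite /frac_lead eqr_div ?cofactor_neq0 // ec.
Qed.

Lemma frac_ord_ex f a : f != 0 -> exists U V,
  [/\ U.[a] != 0, V.[a] != 0
    & f = ('X - a%:P)%:F ^ frac_ord f a * (U%:F / V%:F)].
Proof.
move=> f0; have dn0 := fden_neq0 f.
have nn0 : fnum f != 0.
  by apply: contraNneq f0 => n0; rewrite (frac_fnumden f) n0 tofrac0 mul0r.
have XF0 : ('X - a%:P)%:F != 0 by rewrite tofrac_eq0 polyXsubC_eq0.
have [U eU hU] := cofactorE a nn0; have [V eV hV] := cofactorE a dn0.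
exists U, V; rewrite eU eV !cofactor_neq0 //; split=> //.
rewrite [LHS]frac_fnumden {1}hU {1}hV !tofracM !tofracXn /frac_ord.
by rewrite expfzDr // -exprnN -mulf_div mulrC.
Qed.

Lemma ind_at_nonpole f a : ~~ root (fden f) a -> ind_at f a = 0.
Proof.
move=> ra; rewrite /ind_at /ind_right /ind_left /frac_ord (mupNroot ra) subr0.
by rewrite lez_nat leq0n orbT subr0.
Qed.

Lemma cauchy_index0 a b U V : U = 0 \/ V = 0 ->
  cauchy_index a b (U%:F / V%:F) = 0.
Proof.
move=> UV; have -> : U%:F / V%:F = 0.
  by case: UV => ->; rewrite tofrac0 ?mul0r ?invr0 ?mulr0.
rewrite /cauchy_index /ind_at /ind_right /ind_left eqxx /= subr0.
by rewrite big1 ?addr0 // subr0.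
Qed.

End RationalFunctions.

Section Paths.

Variable R : rcfType.
Implicit Types (P F : {poly R[i]}) (u v : R[i]).

Definition re_poly P : {poly R} := map_poly (@complex.Re R) P.
Definition im_poly P : {poly R} := map_poly (@complex.Im R) P.

Lemma re_im_poly P :
  P = map_poly (real_complex R) (re_poly P)
      + ('i)%:P * map_poly (real_complex R) (im_poly P).
Proof.
apply/polyP => k; rewrite coefD coefCM !coef_map_id0 ?rmorph0 //.
by case: P`_k => x y; simpc.
Qed.

(* Only the values of [pp_time] at 0, ..., n and of [pp_poly] at 0, ..., n - 1
   are relevant, where n = [pp_size]: the path is given by [pp_poly k] on
   [pp_time k, pp_time k.+1]. *)
Record pp_path := PPPath {
  pp_size : nat;
  pp_time : nat -> R;
  pp_poly : nat -> {poly R[i]};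
  pp_time_start : pp_time 0 = 0;
  pp_time_end : pp_time pp_size = 1;
  pp_time_incr : forall k, (k < pp_size)%N -> pp_time k < pp_time k.+1;
  pp_cont : forall k, (k.+1 < pp_size)%N ->
    (pp_poly k).[(pp_time k.+1)%:C] = (pp_poly k.+1).[(pp_time k.+1)%:C]
}.

Definition winding (g : pp_path) : rat :=
  2^-1 * \sum_(k < pp_size g)
    cauchy_index (pp_time g k) (pp_time g k.+1)
      ((re_poly (pp_poly g k))%:F / (im_poly (pp_poly g k))%:F).

Lemma pp_comp_cont F (g : pp_path) k : (k.+1 < pp_size g)%N ->
  (F \Po pp_poly g k).[(pp_time g k.+1)%:C]
    = (F \Po pp_poly g k.+1).[(pp_time g k.+1)%:C].
Proof. by move=> hk; rewrite !horner_comp pp_cont. Qed.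

Definition pp_comp F (g : pp_path) : pp_path :=
  PPPath (pp_time_start g) (pp_time_end g) (@pp_time_incr g)
    (@pp_comp_cont F g).

(* The affine polynomial with value u at s and v at t. *)
Definition segment (s t : R) u v : {poly R[i]} :=
  u%:P + ((v - u) / (t - s)%:C)%:P * ('X - (s%:C)%:P).

Lemma segment_start s t u v : (segment s t u v).[s%:C] = u.
Proof. by rewrite /segment !hornerE subrr mulr0 addr0. Qed.

Lemma segment_end s t u v : s < t -> (segment s t u v).[t%:C] = v.
Proof.
move=> st; rewrite /segment !hornerE -rmorphB divfK ?subrKC //.
by rewrite fmorph_eq0 subr_eq0 gt_eqF.
Qed.

End Paths.

Section Rectangle.

Variable R : rcfType.
Variables x0 x1 y0 y1 : R.

Definition rect_vertices : seq R[i] :=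
  [:: x0 +i* y0; x1 +i* y0; x1 +i* y1; x0 +i* y1].

Definition quarter (k : nat) : R := k%:R / 4.

Definition rect_corner (k : nat) : R[i] := nth 0 rect_vertices (k %% 4).

Definition rect_piece (k : nat) : {poly R[i]} :=
  segment (quarter k) (quarter k.+1) (rect_corner k) (rect_corner k.+1).

Lemma quarter0 : quarter 0 = 0.
Proof. exact: mul0r. Qed.

Lemma quarter4 : quarter 4 = 1.
Proof. by rewrite /quarter divff ?pnatr_eq0. Qed.

Lemma quarter_incr k : (k < 4)%N -> quarter k < quarter k.+1.
Proof. by move=> _; rewrite ltr_pM2r ?invr_gt0 ?ltr0n // ltr_nat. Qed.

Lemma rect_piece_cont k : (k.+1 < 4)%N ->
  (rect_piece k).[(quarter k.+1)%:C] = (rect_piece k.+1).[(quarter k.+1)%:C].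
Proof.
by move=> hk; rewrite segment_start segment_end // quarter_incr // ltnW.
Qed.

Definition rect_path : pp_path R :=
  PPPath quarter0 quarter4 quarter_incr rect_piece_cont.

Definition in_interior (z : R[i]) : bool :=
  (x0 < complex.Re z < x1) && (y0 < complex.Im z < y1).

Definition in_edge (z : R[i]) : bool :=
  ((x0 < complex.Re z < x1) &&
     ((complex.Im z == y0) || (complex.Im z == y1))) ||
  ((y0 < complex.Im z < y1) &&
     ((complex.Re z == x0) || (complex.Re z == x1))).

Definition winding_rect (F : {poly R[i]}) : rat :=
  winding (pp_comp F rect_path).

End Rectangle.

Definition distinct_roots (R : rcfType) (F : {poly R[i]}) : seq R[i] :=
  undup (sval (closed_field_poly_normal F)).

Lemma distinct_roots_uniq (R : rcfType) (F : {poly R[i]}) :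
  uniq (distinct_roots F).
Proof. exact: undup_uniq. Qed.

Lemma mem_distinct_roots (R : rcfType) (F : {poly R[i]}) z :
  F != 0 -> (z \in distinct_roots F) = root F z.
Proof.
move=> F0.
have rootE (r : seq R[i]) c : c != 0 -> F = c *: \prod_(w <- r) ('X - w%:P) ->
    root F z = (z \in r).
  by move=> c0 ->; rewrite rootZ // root_prod_XsubC.
rewrite mem_undup (rootE _ _ _ (svalP (closed_field_poly_normal F))) //.
by rewrite lead_coef_eq0.
Qed.

Definition root_count (R : rcfType) (x0 x1 y0 y1 : R) (F : {poly R[i]}) : rat :=
  \sum_(z <- distinct_roots F | in_interior x0 x1 y0 y1 z) (mup z F)%:R
  + \sum_(z <- distinct_roots F | in_edge x0 x1 y0 y1 z) (mup z F)%:R / 2.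

(* Main.v *)
(** For a path [G = U + i V] the fraction [U / V] is the cotangent of the
    argument, so the indices of [G], [H] and [G H] obey the addition law of the
    cotangent, up to a term that depends only on the values of [G] and [H] at
    the end points of the path. On a subinterval without roots of the
    polynomials involved this is a comparison of signs at an interior point and
    at the end points, and indices add up over subintervals. Around the
    rectangle the end point terms cancel, so the winding number is additive
    over products of polynomials that do not vanish at the vertices. Since [C]
    is algebraically closed, it remains to treat [Z - z]: the horizontal edges
    contribute nothing, and the vertical ones give the product of the sign
    changes of [x - Re z] and [y - Im z], divided by 4. *)

Require Import Defs.
From mathcomp Require Import all_boot all_order all_algebra.
From mathcomp Require Import polyrcf complex.
From mathcomp Require Import ring lra.

Import Order.TTheory GRing.Theory Num.Theory.
Local Open Scope ring_scope.
Local Open Scope complex_scope.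

Local Notation noroot p := (forall x, ~~ root p x).

Set Implicit Arguments.
Unset Strict Implicit.
Unset Printing Implicit Defensive.

Section CauchyIndex.

Variable R : rcfType.
Implicit Types (a b c m x y : R) (P Q U V S T : {poly R}).

(** * Rational-valued signs and one-sided indices at a point *)

Definition sgq x : rat := (sgz x)%:~R.

Lemma sgqM x y : sgq (x * y) = sgq x * sgq y.
Proof. by rewrite /sgq sgzM intrM. Qed.

Lemma sgqV x : sgq x^-1 = sgq x.
Proof.
rewrite /sgq; have [->|x0] := eqVneq x 0; first by rewrite invr0.
case: (ltgtP x 0) x0 => // h _; first by rewrite !ltr0_sgz ?invr_lt0.
by rewrite !gtr0_sgz ?invr_gt0.
Qed.

Lemma sgq_gt0 x : 0 < x -> sgq x = 1.
Proof. by move=> h; rewrite /sgq gtr0_sgz. Qed.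

Lemma sgq_lt0 x : x < 0 -> sgq x = -1.
Proof. by move=> h; rewrite /sgq ltr0_sgz // mulrNz. Qed.

Lemma sgq0 : sgq 0 = 0.
Proof. by rewrite /sgq sgz0. Qed.

Lemma sgqX x n : sgq (x ^+ n) = sgq x ^+ n.
Proof. by rewrite /sgq sgzX rmorphXn. Qed.

Lemma sgq_noroot (i : interval R) P : {in i, noroot P} ->
  {in i &, forall x y, sgq P.[x] = sgq P.[y]}.
Proof.
move=> h x y xi yi; rewrite /sgq -(sgz_sgr P.[x]) -(sgz_sgr P.[y]).
by rewrite (polyrN0_itv h xi yi).
Qed.

(** Once the power of ['X - a%:P] is divided out, no root is left in [i], so the quotient has the
    same sign at [m] as at [a]. *)
Lemma sgq_cofactor (i : interval R) P a m : P != 0 -> a \in i -> m \in i ->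
  {in i, forall t, t != a -> ~~ root P t} ->
  sgq P.[m] = sgq (cofactor_at a P) * sgq (m - a) ^+ mup a P.
Proof.
move=> P0 ai mi h; have [Q eQ hQ] := cofactorE a P0.
have nQ : {in i, noroot Q}.
  move=> t ti; have [->|ta] := eqVneq t a.
    by rewrite /root eQ cofactor_neq0.
  by move: (h t ti ta); rewrite hQ rootM negb_or => /andP[].
rewrite -eQ {1}hQ hornerM horner_exp !hornerE sgqM sgqX.
by rewrite (sgq_noroot nQ mi ai).
Qed.

Lemma ind_regular a U V : V.[a] != 0 ->
  ind_right (U%:F / V%:F) a = 0 /\ ind_left (U%:F / V%:F) a = 0.
Proof.
move=> Va; rewrite /ind_right /ind_left.
have [->|U0] := eqVneq U 0; first by rewrite tofrac0 mul0r eqxx.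
have [Q eQ hQ] := cofactorE a U0.
have [||-> _] := @frac_ordP _ (U%:F / V%:F) a (mup a U)%:Z Q V _ Va.
- by rewrite eQ cofactor_neq0.
- by rewrite {1}hQ tofracM tofracXn mulrCA mulrA.
by rewrite orbT.
Qed.

(** The exponent of ['X - a%:P] in [U / V] is [- mup a V]. A quotient has the sign of the
    corresponding product, and [(-1) ^ n] does not depend on the sign of [n]. *)
Lemma ind_pole a U V : V != 0 -> V.[a] = 0 -> U.[a] != 0 ->
  ind_right (U%:F / V%:F) a = sgq (U.[a] * cofactor_at a V) / 2
  /\ ind_left (U%:F / V%:F) a
     = (-1) ^+ mup a V * (sgq (U.[a] * cofactor_at a V) / 2).
Proof.
move=> V0 Va Ua; have [Q eQ hQ] := cofactorE a V0.
have n0 : (0 < mup a V)%N by rewrite -XsubC_dvd // dvdp_XsubCl /root Va.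
have [||eo el] :=
    @frac_ordP _ (U%:F / V%:F) a (- (mup a V)%:Z) U Q Ua.
- by rewrite eQ cofactor_neq0.
- by rewrite {1}hQ tofracM tofracXn invfM -exprnN mulrA mulrC.
have f0 : (U%:F / V%:F == 0 :> {fraction {poly R}}) = false.
  rewrite mulf_eq0 invr_eq0 !tofrac_eq0 (negPf V0) orbF.
  by apply: contraNF Ua => /eqP->; rewrite horner0.
rewrite /ind_right /ind_left f0 eo el oppr_ge0 lez_nat leqNgt n0 /=.
rewrite eQ -/(sgq _) !sgqM sgqV -exprnN -signr_odd.
by case: odd; rewrite ?invrN ?invr1 ?mulrA.
Qed.

(** * Indices over intervals without interior roots, and subdivision *)

Definition poly_settled a b P := P = 0 \/ {in `]a, b[, noroot P}.

(** Only poles at the end points contribute. At [b] the sign [(-1) ^+ mup b V] in the left index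
    cancels against the sign of [(m - b) ^+ mup b V], so both ends see the sign of [U / V] at
    [m]. *)
Lemma cauchy_index_settled a b m U V : m \in `]a, b[ ->
  poly_settled a b U -> poly_settled a b V ->
  (U.[a] != 0) || (V.[a] != 0) -> (U.[b] != 0) || (V.[b] != 0) ->
  cauchy_index a b (U%:F / V%:F)
  = sgq (U.[m] * V.[m]) * ((V.[a] == 0)%:R - (V.[b] == 0)%:R) / 2.
Proof.
move=> mab; case=> [->|nU].
  rewrite cauchy_index0; last by left.
  by rewrite (horner0 m) [_ * V.[m]]mul0r sgq0 !mul0r.
case=> [->|nV].
  rewrite cauchy_index0; last by right.
  by rewrite (horner0 m) [U.[m] * _]mulr0 sgq0 !mul0r.
have U0 : U != 0 by apply: contraNneq (nU _ mab) => ->; rewrite root0.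
have V0 : V != 0 by apply: contraNneq (nV _ mab) => ->; rewrite root0.
move: (mab); rewrite in_itv /= => /andP[am mb].
have sub c P : c = a \/ c = b -> {in `]a, b[, noroot P} ->
    P != 0 -> sgq P.[m] = sgq (cofactor_at c P) * sgq (m - c) ^+ mup c P.
  move=> hc nP P0; case: hc => ->.
    apply: (@sgq_cofactor `[a, b[) => //;
      rewrite ?in_itv /= ?lexx ?am ?mb ?(ltW am) ?(lt_trans am) // => t.
    rewrite !in_itv /= => /andP[at_ tb] ta; apply: nP.
    by rewrite in_itv /= tb lt_neqAle eq_sym ta at_.
  apply: (@sgq_cofactor `]a, b]) => //;
    rewrite ?in_itv /= ?lexx ?am ?mb ?(ltW mb) ?(lt_trans am) // => t.
  rewrite !in_itv /= => /andP[at_ tb] ta; apply: nP.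
  by rewrite in_itv /= at_ lt_neqAle ta tb.
have cofr P c : P.[c] != 0 -> cofactor_at c P = P.[c] /\ mup c P = 0%N.
  move=> Pc; have m0 : mup c P = 0%N by apply: mupNroot.
  by rewrite /cofactor_at m0 expr0 divp1.
move=> ha hb; rewrite /cauchy_index big1_seq; last first.
  move=> x /andP[_ /roots_in xab]; rewrite /ind_at.
  by have [|-> ->] := @ind_regular x U V; [exact: nV | rewrite subr0].
rewrite addr0 mulrBr mulrBl; congr (_ - _).
  have [Va|Va] := eqVneq V.[a] 0; last first.
    by have [-> _] := ind_regular U Va; rewrite mulr0 mul0r.
  move: ha; rewrite Va eqxx orbF => Ua.
  have [-> _] := ind_pole V0 Va Ua; rewrite !sgqM !(sub a) //; try by left.
  have [-> ->] := cofr _ _ Ua.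
  by rewrite (sgq_gt0 (x := m - a)) ?subr_gt0 // !expr1n !mulr1.
have [Vb|Vb] := eqVneq V.[b] 0; last first.
  by have [_ ->] := ind_regular U Vb; rewrite mulr0 mul0r.
move: hb; rewrite Vb eqxx orbF => Ub.
have [_ ->] := ind_pole V0 Vb Ub; rewrite !sgqM !(sub b) //; try by right.
have [-> ->] := cofr _ _ Ub.
rewrite (sgq_lt0 (x := m - b)) ?subr_lt0 // !mulr1.
by rewrite !mulrA [in LHS]mulrC !mulrA mulrAC; ring.
Qed.

(** The left index at [b] from the first interval and the right index at [b] from the second combine
    to the full index at [b], which is 0 unless [b] is a root of the denominator. *)
Lemma cauchy_index_chasles a b c f : a < b -> b < c ->
  cauchy_index a c f = cauchy_index a b f + cauchy_index b c f.
Proof.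
move=> ab bc; have d0 := fden_neq0 f.
pose s := roots (fden f) a b ++
  (if root (fden f) b then [:: b] else [::]) ++ roots (fden f) b c.
have ps : perm_eq (roots (fden f) a c) s.
  have mb : (if root (fden f) b then [:: b] else [::]) =i
      [pred x | (x == b) && root (fden f) x].
    by move=> x; rewrite inE; case: ifP => rb; rewrite ?inE;
       case: eqVneq => // ->; rewrite rb.
  have ub : uniq (if root (fden f) b then [:: b] else [::]) by case: ifP.
  apply: uniq_perm; rewrite ?uniq_roots //.
    rewrite !cat_uniq !uniq_roots ub /= andbT; apply/andP; split.
      apply/hasPn => x; rewrite mem_cat mb inE /= !in_roots !in_itv /=.
      by case/orP=> [/andP[/eqP-> _]|/and3P[_ /andP[bx _] _]];
         rewrite ?ltxx ?andbF //;
         apply/negP => /and3P[_ /andP[_ /(lt_trans bx)]];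
         rewrite ltxx.
    apply/hasPn => x; rewrite /= mb inE in_roots in_itv /=.
    by case/and3P=> _ /andP[bx _] _; rewrite gt_eqF.
  move=> x; rewrite !mem_cat mb inE !in_roots !in_itv /= d0 !andbT.
  case: (root _ x); rewrite ?andbF //= andbT.
  case: (ltgtP x b) => [xb|bx|->]; rewrite ?andbF ?andbT ?orbF ?ab ?bc //=.
    by rewrite (lt_trans xb bc) andbT.
  by rewrite (lt_trans ab bx).
have eb : \sum_(x <- (if root (fden f) b then [:: b] else [::])) ind_at f x
    = ind_right f b - ind_left f b.
  case: ifP => rb; first by rewrite big_seq1.
  by rewrite big_nil -/(ind_at f b) ind_at_nonpole ?rb.
by rewrite /cauchy_index (perm_big _ ps) !big_cat eb /=; ring.
Qed.

(** * The addition law for indices of products *)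

Lemma sgq_sqr x : x != 0 -> sgq x * sgq x = 1.
Proof.
move=> x0; rewrite -sgqM sgq_gt0 // -expr2.
by rewrite lt_neqAle eq_sym sqrf_eq0 x0 sqr_ge0.
Qed.

(** If [p] and [q] have opposite signs, both sides are minus the sign of the weighted sum, so that
    undetermined sign need not be known. *)
Lemma sgq_weighted_sum x y p q : 0 < x -> 0 < y ->
  sgq p + sgq q - sgq (x * p + y * q) = sgq (x * p + y * q) * (sgq p * sgq q).
Proof.
move=> x0 y0.
have [p0|p0|->] := ltgtP p 0;
  last by rewrite sgq0 mulr0 !add0r sgqM (sgq_gt0 y0); ring.
  rewrite (sgq_lt0 p0).
  have [q0|q0|->] := ltgtP q 0; last first.
  - by rewrite sgq0 mulr0 !addr0 sgqM (sgq_gt0 x0) (sgq_lt0 p0); ring.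
  - by rewrite (sgq_gt0 q0); ring.
  - by rewrite (sgq_lt0 q0) sgq_lt0 //; nra.
rewrite (sgq_gt0 p0).
have [q0|q0|->] := ltgtP q 0; last first.
- by rewrite sgq0 mulr0 !addr0 sgqM (sgq_gt0 x0) (sgq_gt0 p0); ring.
- by rewrite (sgq_gt0 q0) sgq_gt0 //; nra.
- by rewrite (sgq_lt0 q0); ring.
Qed.

(* The primed letters are values at a point near the one where [u, v, s, t] are
   taken, so close that nonzero values keep their sign. *)
Lemma sgq_product_germ (u v s t u' v' s' t' : R) :
  (u != 0) || (v != 0) -> (s != 0) || (t != 0) ->
  (u != 0 -> sgq u' = sgq u) -> (v != 0 -> sgq v' = sgq v) ->
  (s != 0 -> sgq s' = sgq s) -> (t != 0 -> sgq t' = sgq t) ->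
  (u * s - v * t != 0 ->
     sgq (u' * s' - v' * t') = sgq (u * s - v * t)) ->
  (u * t + v * s != 0 ->
     sgq (u' * t' + v' * s') = sgq (u * t + v * s)) ->
  sgq (u' * v') * (v == 0)%:R + sgq (s' * t') * (t == 0)%:R
  - sgq ((u' * s' - v' * t') * (u' * t' + v' * s')) * (u * t + v * s == 0)%:R
  = sgq ((u' * t' + v' * s') * (v' * t')) - sgq ((u * t + v * s) * (v * t)).
Proof.
move=> uv st hu hv hs ht hm hw.
have nz (x y : R) : x != 0 -> sgq y = sgq x -> y != 0.
  move=> x0 e; apply: contraNneq x0 => y0; move: e; rewrite y0 sgq0 => /eqP.
  by rewrite eq_sym /sgq intr_eq0 sgz_eq0.
have [v0|v0] := eqVneq v 0; have [t0|t0] := eqVneq t 0.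
(* Both factors have a pole. The weights [s' ^+ 2] and [u' ^+ 2] make the weighted sum equal to
   [u' * s'] times the imaginary part of the product. *)
- move: uv st hm; rewrite v0 t0 eqxx !orbF => u0 s0.
  rewrite !mul0r !mulr0 subr0 addr0 eqxx => /(_ (mulf_neq0 u0 s0)) hm.
  have u'0 := nz _ _ u0 (hu u0); have s'0 := nz _ _ s0 (hs s0).
  have := @sgq_weighted_sum (s' ^+ 2) (u' ^+ 2) (u' * v') (s' * t').
  rewrite !lt_neqAle !sqr_ge0 !andbT ![0 == _]eq_sym !sqrf_eq0 => /(_ s'0 u'0).
  have -> : s' ^+ 2 * (u' * v') + u' ^+ 2 * (s' * t')
    = (u' * s') * (u' * t' + v' * s') by ring.
  rewrite !mulr1 sgq0 subr0 !sgqM hm sgqM -(hu u0) -(hs s0) => ->.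
  rewrite -[RHS]mul1r -(sgq_sqr u'0) -[RHS]mul1r -(sgq_sqr s'0); ring.
(* Exactly one factor has a pole, here and in the next case. The imaginary part of the product is
   then nonzero, so the product has none. *)
- have u0 : u != 0 by move: uv; rewrite v0 eqxx orbF.
  move: hw; rewrite v0 mul0r addr0 mulf_eq0 (negPf u0) (negPf t0).
  move=> /(_ isT) hw.
  rewrite !mul0r !mulr0 sgq0 !sgqM hw !sgqM -(hu u0) -(ht t0).
  rewrite -[LHS]mulr1 -[X in _ * X = _](sgq_sqr (nz _ _ t0 (ht t0))) /=; ring.
- have s0 : s != 0 by move: st; rewrite t0 eqxx orbF.
  move: hw; rewrite t0 mulr0 add0r mulf_eq0 (negPf v0) (negPf s0).
  move=> /(_ isT) hw.
  rewrite !mulr0 sgq0 !sgqM hw !sgqM -(hs s0) -(hv v0).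
  rewrite -[LHS]mulr1 -[X in _ * X = _](sgq_sqr (nz _ _ v0 (hv v0))) /=; ring.
rewrite !mulr0 addr0 add0r.
have [w0|w0] := eqVneq (u * t + v * s) 0; last first.
  by rewrite mulr0 oppr0 !sgqM hw // hv // ht // subrr.
rewrite w0 mul0r sgq0 subr0 mulr1.
(* The product has a pole although neither factor has one: its real part then has the sign opposite
   to [v * t]. *)
have em : (u * s - v * t) * (v * t) = - t ^+ 2 * (u ^+ 2 + v ^+ 2).
  have -> : (u * s - v * t) * (v * t)
    = u * t * (u * t + v * s) - t ^+ 2 * (u ^+ 2 + v ^+ 2) by ring.
  by rewrite w0 mulr0 sub0r mulNr.
have m0 : (u * s - v * t) * (v * t) < 0.
  rewrite em mulNr oppr_lt0 mulr_gt0 //.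
    by rewrite lt_neqAle eq_sym sqrf_eq0 t0 sqr_ge0.
  rewrite ltr_wpDl ?sqr_ge0 // lt_neqAle eq_sym sqrf_eq0 v0 sqr_ge0 //.
have mn : u * s - v * t != 0 by apply: contraTneq m0 => ->; rewrite mul0r ltxx.
have := sgq_lt0 m0; rewrite !sgqM hm // (hv v0) (ht t0) => e.
move: e (sgq_sqr v0) (sgq_sqr t0).
move: (sgq _) (sgq _) (sgq v) (sgq t) => B A C D e c d.
(* As [C * D] has square 1, this extracts [A = - (C * D)] from [A * (C * D) = -1]. *)
have -> : A = A * (C * D) * (C * D) + A * (1 - C * C * (D * D)) by ring.
by rewrite e c d; ring.
Qed.

Lemma poly_settled_dvd a b P Q : P %| Q -> {in `]a, b[, noroot Q} ->
  poly_settled a b P.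
Proof.
move=> PQ nQ; right=> x xab; apply: contra (nQ x xab).
by rewrite -!dvdp_XsubCl => /dvdp_trans; apply.
Qed.

(** Between [m] and [c] all points other than [c] lie in []a, b[], so no root separates them, even
    when [c] is an end point. *)
Lemma poly_settled_sgq a b c m P : a <= c <= b -> m \in `]a, b[ ->
  poly_settled a b P -> P.[c] != 0 -> sgq P.[m] = sgq P.[c].
Proof.
move=> /andP[ac cb] mab; case=> [->|nP Pc]; first by rewrite horner0 eqxx.
have P0 : P != 0 by apply: contraNneq Pc => ->; rewrite horner0.
move: mab; rewrite in_itv /= => /andP[am mb].
have nP' x : a < x < b \/ x = c -> ~~ root P x.
  by case=> [h|->//]; apply: nP; rewrite in_itv.
have [mc|mc] := leP m c.
  apply: (@sgq_noroot `[m, c]) => [x||]; rewrite ?in_itv /= ?mc ?lexx //.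
  move=> /andP[mx xc]; apply: nP'; rewrite (lt_le_trans am mx) /=.
  by move: xc; rewrite le_eqVlt => /orP[/eqP->|xc];
    [right | left; exact: lt_le_trans cb].
apply: (@sgq_noroot `[c, m]) => [x||]; rewrite ?in_itv /= ?(ltW mc) ?lexx //.
move=> /andP[cx xm]; apply: nP'; rewrite (le_lt_trans xm mb) andbT.
by move: cx; rewrite le_eqVlt => /orP[/eqP->|cx];
  [right | left; exact: le_lt_trans cx].
Qed.

Definition nonvanishing U V a b :=
  forall x, a <= x <= b -> (U.[x] != 0) || (V.[x] != 0).

(* The sign of [U / V + S / T] at [x], or 0 if one of the two has a pole
   there. *)
Definition product_defect U V S T x : rat :=
  sgq ((U * T + V * S).[x] * (V * T).[x]).

(** The norm [u ^+ 2 + v ^+ 2] of [u + i v] is multiplicative and vanishes only at 0. *)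
Lemma product_nonvanishing U V S T a b :
  nonvanishing U V a b -> nonvanishing S T a b ->
  nonvanishing (U * S - V * T) (U * T + V * S) a b.
Proof.
move=> h1 h2 x xab; move: (h1 x xab) (h2 x xab); rewrite !hornerE.
move: U.[x] V.[x] S.[x] T.[x] => u v s t {h1 h2} uv st.
have sq (p q : R) : (p != 0) || (q != 0) = (p ^+ 2 + q ^+ 2 != 0).
  by rewrite paddr_eq0 ?sqr_ge0 // !sqrf_eq0 negb_and.
move: uv st; rewrite !sq => uv st.
have -> : (u * s - v * t) ^+ 2 + (u * t + v * s) ^+ 2
  = (u ^+ 2 + v ^+ 2) * (s ^+ 2 + t ^+ 2) by ring.
exact: mulf_neq0.
Qed.

Lemma cauchy_index_product_settled a b m U V S T : m \in `]a, b[ ->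
  nonvanishing U V a b -> nonvanishing S T a b ->
  poly_settled a b U -> poly_settled a b V ->
  poly_settled a b S -> poly_settled a b T ->
  poly_settled a b (U * S - V * T) -> poly_settled a b (U * T + V * S) ->
  cauchy_index a b (U%:F / V%:F) + cauchy_index a b (S%:F / T%:F)
  - cauchy_index a b ((U * S - V * T)%:F / (U * T + V * S)%:F)
  = (product_defect U V S T b - product_defect U V S T a) / 2.
Proof.
move=> mab uv st hU hV hS hT hM hW.
have hm := product_nonvanishing uv st.
have aab : a <= a <= b /\ a <= b <= b.
  move: mab; rewrite in_itv /= !lexx.
  by move=> /andP[/ltW am /ltW /(le_trans am) ->].
case: aab => aa bb.
rewrite !(cauchy_index_settled mab) ?uv ?st ?hm //.
(* The local sign identity compares [c] with [m]. Subtracting its instances at [a] and [b] removes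
   the defect at [m]. *)
have germ c : a <= c <= b ->
  sgq (U.[m] * V.[m]) * (V.[c] == 0)%:R + sgq (S.[m] * T.[m]) * (T.[c] == 0)%:R
  - sgq ((U * S - V * T).[m] * (U * T + V * S).[m])
    * ((U * T + V * S).[c] == 0)%:R
  = product_defect U V S T m - product_defect U V S T c.
  move=> cab; have sg P := @poly_settled_sgq a b c m P cab mab.
  have := sg _ hM; have := sg _ hW; rewrite /product_defect.
  rewrite !(hornerD, hornerN, hornerM) => sW sM.
  by apply: sgq_product_germ; rewrite ?uv ?st //; exact: sg.
have := germ a aa; have := germ b bb.
set x1 := sgq _; set x2 := sgq _; set x3 := sgq _ => e1 e2.
have -> : product_defect U V S T b - product_defect U V S T a
  = product_defect U V S T m - product_defect U V S T a
    - (product_defect U V S T m - product_defect U V S T b) by ring.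
by rewrite -e1 -e2; ring.
Qed.

(** Induction on the number of roots of [D] in []a, b[]: a cut at the smallest one leaves none to
    its left and one fewer to its right. *)
Lemma poly_interval_ind D (p : R -> R -> Prop) : D != 0 ->
  (forall a b, a < b -> {in `]a, b[, noroot D} -> p a b) ->
  (forall a b c, a < b -> b < c -> p a b -> p b c -> p a c) ->
  forall a b, a < b -> p a b.
Proof.
move=> D0 pe pc a b ab; have [n] := ubnP (size (roots D a b)).
elim: n a ab => // n IH a ab sn.
case er : (roots D a b) sn => [|x s] sn.
  by apply: pe => //; apply: roots_nil.
move/eqP: er; rewrite roots_cons => /and5P[_ xab /eqP ra _ /eqP rb].
move: xab; rewrite in_itv /= => /andP[ax xb].
apply: (pc a x b) => //; first by apply: pe => //; apply: roots_nil.
by apply: IH => //; rewrite rb.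
Qed.

(* With [f = U / V] and [g = S / T], the fraction on the right is
   [(f g - 1) / (f + g)], the addition law of the cotangent. *)
Lemma cauchy_index_product a b U V S T : a < b ->
  nonvanishing U V a b -> nonvanishing S T a b ->
  cauchy_index a b (U%:F / V%:F) + cauchy_index a b (S%:F / T%:F)
  - cauchy_index a b ((U * S - V * T)%:F / (U * T + V * S)%:F)
  = (product_defect U V S T b - product_defect U V S T a) / 2.
Proof.
(* Zero polynomials are replaced by 1 to keep [D] nonzero; they are settled on every interval
   anyway. *)
pose nz P := if P == 0 then 1 else P.
pose D := \prod_(P <- [:: U; V; S; T; U * S - V * T; U * T + V * S]) nz P.
have D0 : D != 0.
  by rewrite prodf_seq_neq0; apply/allP => P _; rewrite /nz;
     case: (eqVneq P 0) => //= _; exact: oner_neq0.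
move=> ab; move: a b ab.
apply: (poly_interval_ind D0) => [a b ab nD | a b c ab bc IH1 IH2] uv st.
  have se P : P \in [:: U; V; S; T; U * S - V * T; U * T + V * S] ->
      poly_settled a b P.
    move=> hP; have [->|P0] := eqVneq P 0; first by left.
    apply: (poly_settled_dvd _ nD); rewrite /D (big_rem P) //= /nz (negPf P0).
    exact: dvdp_mulIl.
  have mab : (a + b) / 2 \in `]a, b[ by rewrite in_itv /=; lra.
  by apply: (cauchy_index_product_settled mab) => //; apply: se;
     rewrite !inE eqxx ?orbT.
have l x : a <= x <= b -> a <= x <= c.
  by move=> /andP[-> /le_trans ->] //; exact: ltW.
have r x : b <= x <= c -> a <= x <= c.
  by move=> /andP[/(le_trans (ltW ab)) -> ->].
rewrite !(cauchy_index_chasles _ ab bc).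
have := IH1 (fun x h => uv x (l x h)) (fun x h => st x (l x h)).
have := IH2 (fun x h => uv x (r x h)) (fun x h => st x (r x h)).
move=> e2 e1.
have -> : (product_defect U V S T c - product_defect U V S T a) / 2
  = (product_defect U V S T b - product_defect U V S T a) / 2
    + (product_defect U V S T c - product_defect U V S T b) / 2 by ring.
by rewrite -e1 -e2; ring.
Qed.

(** * Constant numerators or denominators, and common factors *)

Lemma cauchy_index_nopole a b U V : (forall x, V.[x] != 0) ->
  cauchy_index a b (U%:F / V%:F) = 0.
Proof.
move=> hV; rewrite /cauchy_index big1 => [|x _].
  by have [-> _] := ind_regular U (hV a); have [_ ->] := ind_regular U (hV b).
by rewrite /ind_at; have [-> ->] := ind_regular U (hV x).
Qed.

Lemma cauchy_index_polyC_den a b U v : cauchy_index a b (U%:F / (v%:P)%:F) = 0.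
Proof.
have [->|v0] := eqVneq v 0.
  by apply: cauchy_index0; right; rewrite polyC0.
by apply: cauchy_index_nopole => x; rewrite hornerC.
Qed.

Lemma cauchy_index_polyC_num a b u V : a < b ->
  cauchy_index a b ((u%:P)%:F / V%:F)
  = (sgq (u * V.[b]) - sgq (u * V.[a])) / 2.
Proof.
move=> ab; have [->|u0] := eqVneq u 0.
  by rewrite polyC0 cauchy_index0; [rewrite !mul0r subrr mul0r | left].
(* Multiplication by [i] turns [u / V] into [- V / u], whose denominator is constant; only the
   defect terms survive. *)
have := @cauchy_index_product a b u%:P V 0 1 ab.
rewrite !mulr0 !mulr1 sub0r addr0 (cauchy_index_polyC_den a b (- V)).
rewrite (@cauchy_index0 _ a b 0 1); last by left.
rewrite /product_defect !mulr1 !mulr0 !addr0 ?subr0 !hornerC => -> // x _.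
  by rewrite hornerC u0.
by rewrite !hornerE oner_neq0 orbT.
Qed.

(** Dividing by the gcd keeps the fraction [U / V] and removes the common real roots, that is, the
    zeros of the path [U + i V]. *)
Lemma coprime_decomposition U V : (U != 0) || (V != 0) ->
  exists D U' V', [/\ D != 0, U = U' * D, V = V' * D
    & forall x, (U'.[x] != 0) || (V'.[x] != 0)].
Proof.
move=> UV; have D0 : gcdp U V != 0 by rewrite gcdp_eq0 negb_and.
exists (gcdp U V), (U %/ gcdp U V), (V %/ gcdp U V); split=> //.
- by rewrite divpK // dvdp_gcdl.
- by rewrite divpK // dvdp_gcdr.
move=> x; rewrite -implyNb negbK; apply/implyP => rU.
by apply: coprimep_root rU; apply: coprimep_div_gcd.
Qed.

Lemma tofrac_cancelr U V P : P != 0 -> (U * P)%:F / (V * P)%:F = U%:F / V%:F.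
Proof.
by move=> P0; rewrite !tofracM invfM mulrACA divff ?mulr1 // tofrac_eq0.
Qed.

End CauchyIndex.

(** * Indices of complex polynomials over real intervals *)

Section ComplexPolynomials.

Variable R : rcfType.
Implicit Types (a b s t : R) (u v z w : R[i]) (P Q F : {poly R[i]}).

Lemma coef_re_poly P k : (re_poly P)`_k = complex.Re P`_k.
Proof. by rewrite coef_map_id0. Qed.

Lemma coef_im_poly P k : (im_poly P)`_k = complex.Im P`_k.
Proof. by rewrite coef_map_id0. Qed.

Lemma re_im_polyP P (U V : {poly R}) :
  (forall k, P`_k = U`_k +i* V`_k) -> re_poly P = U /\ im_poly P = V.
Proof.
by move=> h; split; apply/polyP => k; rewrite ?coef_re_poly ?coef_im_poly h.
Qed.

Lemma re_im_polyM P Q :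
  re_poly (P * Q) = re_poly P * re_poly Q - im_poly P * im_poly Q /\
  im_poly (P * Q) = re_poly P * im_poly Q + im_poly P * re_poly Q.
Proof.
apply: re_im_polyP => k; rewrite coefD coefN !coefD !coefM.
rewrite -sumrN -!big_split /=.
elim/big_ind3: _ => [|x1 x2 x3 y1 y2 y3 -> ->|i _] //.
rewrite !coef_re_poly !coef_im_poly.
by case: P`_i => p q; case: Q`_(k - i).
Qed.

Lemma horner_re_im_poly P t :
  P.[t%:C] = (re_poly P).[t] +i* (im_poly P).[t].
Proof.
rewrite {1}(re_im_poly P) hornerD hornerM hornerC !horner_map /=.
by simpc.
Qed.

Lemma horner_im_poly P t : (im_poly P).[t] = complex.Im P.[t%:C].
Proof. by rewrite horner_re_im_poly. Qed.

Definition arg_index a b P : rat :=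
  cauchy_index a b ((re_poly P)%:F / (im_poly P)%:F).

(** For nonzero imaginary parts this is the sign of the sum of the cotangents of the arguments of
    [z] and [w]. *)
Definition arg_defect z w : rat :=
  sgq (complex.Im (z * w) * (complex.Im z * complex.Im w)).

Lemma sgq_mul_sqr (x y : R) : y != 0 -> sgq (x * y ^+ 2) = sgq x.
Proof. by move=> y0; rewrite sgqM expr2 sgqM sgq_sqr // mulr1. Qed.

(** Zeros of [P] and [Q] inside the interval, which come from roots on an edge, are handled by
    passing to coprime real and imaginary parts. *)
Lemma arg_indexM a b P Q : a < b ->
  P.[a%:C] != 0 -> P.[b%:C] != 0 -> Q.[a%:C] != 0 -> Q.[b%:C] != 0 ->
  arg_index a b (P * Q) = arg_index a b P + arg_index a b Q
  - (arg_defect P.[b%:C] Q.[b%:C] - arg_defect P.[a%:C] Q.[a%:C]) / 2.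
Proof.
move=> ab Pa Pb Qa Qb.
have nz (G : {poly R[i]}) (x : R) : G.[x%:C] != 0 ->
    (re_poly G != 0) || (im_poly G != 0).
  rewrite -negb_and; apply: contraNN => /andP[/eqP h1 /eqP h2].
  by rewrite horner_re_im_poly h1 h2 !horner0.
have [D [U [V [D0 eU eV nP]]]] := coprime_decomposition (nz _ _ Pa).
have [E [S [T [E0 eS eT nQ]]]] := coprime_decomposition (nz _ _ Qa).
have DE0 : D * E != 0 by rewrite mulf_neq0.
have [eM eW] := re_im_polyM P Q.
have {}eM : re_poly (P * Q) = (U * S - V * T) * (D * E).
  by rewrite eM eU eV eS eT; ring.
have {}eW : im_poly (P * Q) = (U * T + V * S) * (D * E).
  by rewrite eW eU eV eS eT; ring.
(* Restoring the common factors multiplies the argument of [sgq] by the nonzero square of [D.[x] *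
   E.[x]]. *)
have de (x : R) : P.[x%:C] != 0 -> Q.[x%:C] != 0 ->
    arg_defect P.[x%:C] Q.[x%:C] = product_defect U V S T x.
  move=> Px Qx; rewrite /arg_defect -hornerM -!horner_im_poly eW eV eT.
  have Dx : D.[x] != 0.
    apply: contraNneq Px => r.
    by rewrite horner_re_im_poly eU eV !hornerM r !mulr0.
  have Ex : E.[x] != 0.
    apply: contraNneq Qx => r.
    by rewrite horner_re_im_poly eS eT !hornerM r !mulr0.
  rewrite /product_defect -[RHS](sgq_mul_sqr _ (mulf_neq0 Dx Ex)) !hornerM.
  by congr sgq; ring.
rewrite !de // /arg_index eM eW eU eV eS eT !tofrac_cancelr //.
by rewrite -(cauchy_index_product ab) //; ring.
Qed.

Lemma mup_prod_XsubC z (r : seq R[i]) :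
  mup z (\prod_(w <- r) ('X - w%:P)) = count_mem z r.
Proof.
elim: r => [|w r IH]; first by rewrite big_nil mupNroot // root1.
rewrite big_cons mupM ?polyXsubC_eq0 //; last first.
  by rewrite prodf_seq_neq0; apply/allP => v _; rewrite polyXsubC_eq0.
by rewrite IH -['X - _]expr1 mup_XsubCX /=; case: eqP.
Qed.

Lemma sum_undup_count (r : seq R[i]) (A : pred R[i]) (k : rat) :
  \sum_(z <- undup r | A z) (count_mem z r)%:R * k = \sum_(z <- r) (A z)%:R * k.
Proof.
transitivity (\sum_(z <- r | A z) k).
  rewrite -[RHS]big_undup_iterop_count.
  by apply: eq_bigr => z _; rewrite mulr_natl.
rewrite [LHS]big_mkcond; apply: eq_bigr => z _.
by case: (A z); rewrite ?mul1r ?mul0r.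
Qed.

(** * Winding numbers around the rectangle *)

Section Rectangle.

Variables x0 x1 y0 y1 : R.
Hypotheses (hx : x0 < x1) (hy : y0 < y1).

Local Notation corner := (rect_corner x0 x1 y0 y1).
Local Notation piece := (rect_piece x0 x1 y0 y1).
Local Notation wind := (winding_rect x0 x1 y0 y1).

Definition vertex_free F :=
  forall v, v \in rect_vertices x0 x1 y0 y1 -> F.[v] != 0.

Lemma winding_rectE F : wind F
  = 2^-1 * \sum_(k < 4)
      arg_index (quarter R k) (quarter R k.+1) (F \Po piece k).
Proof. by []. Qed.

Lemma rect_piece_start k : (piece k).[(quarter R k)%:C] = corner k.
Proof. exact: segment_start. Qed.

Lemma rect_piece_end k : (k < 4)%N ->
  (piece k).[(quarter R k.+1)%:C] = corner k.+1.
Proof. by move=> hk; rewrite segment_end // quarter_incr. Qed.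

Lemma rect_corner_vertex k : corner k \in rect_vertices x0 x1 y0 y1.
Proof. by apply: mem_nth; rewrite ltn_mod. Qed.

Lemma winding_rectM P Q : vertex_free P -> vertex_free Q ->
  wind (P * Q) = wind P + wind Q.
Proof.
move=> vP vQ; rewrite !winding_rectE -mulrDr; congr (_ * _).
pose d k := arg_defect P.[corner k] Q.[corner k].
rewrite (eq_bigr (fun k : 'I_4 =>
  arg_index (quarter R k) (quarter R k.+1) (P \Po piece k)
  + arg_index (quarter R k) (quarter R k.+1) (Q \Po piece k)
  - (d k.+1 - d k) / 2)); last first.
  move=> k _; rewrite comp_polyM arg_indexM ?quarter_incr // !horner_comp;
    rewrite ?rect_piece_start ?rect_piece_end //;
    by [apply/vP/rect_corner_vertex | apply/vQ/rect_corner_vertex].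
rewrite big_split sumrN big_split /= -mulr_suml.
(* The sum telescopes to [d 4 - d 0], which is 0 because corners are indexed modulo 4. *)
rewrite -(big_mkord xpredT (fun k => d k.+1 - d k)) telescope_sumr //.
by rewrite subrr mul0r subr0.
Qed.

Lemma re_im_segment s t u v z :
  let B := (v - u) / (t - s)%:C in
  re_poly (('X - z%:P) \Po segment s t u v)
  = (complex.Re (u - z))%:P + (complex.Re B)%:P * ('X - s%:P) /\
  im_poly (('X - z%:P) \Po segment s t u v)
  = (complex.Im (u - z))%:P + (complex.Im B)%:P * ('X - s%:P).
Proof.
move=> B; apply: re_im_polyP => k.
rewrite comp_polyB comp_polyX comp_polyC /segment -/B addrAC -rmorphB /=.
rewrite !coefD !coefCM !coefB !coefC !coefX.
case: B (u - z) => [p q] [g h].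
by case: k => [|[|k]] /=; simpc;
  rewrite ?mulr0 ?mulr1 ?mul0r ?sub0r ?subr0 ?addr0 ?add0r.
Qed.

Lemma arg_index_horizontal s t u v z : complex.Im u = complex.Im v ->
  arg_index s t (('X - z%:P) \Po segment s t u v) = 0.
Proof.
move=> uv; rewrite /arg_index; have [_ ->] := re_im_segment s t u v z.
have -> : complex.Im ((v - u) / (t - s)%:C) = 0.
  rewrite -fmorphV; case: u v uv => [u1 u2] [v1 v2] /= ->.
  by rewrite mulr0 add0r subrr mul0r.
by rewrite polyC0 mul0r addr0 cauchy_index_polyC_den.
Qed.

(** The real part is constant along the segment, so the formula for constant numerators applies. *)
Lemma arg_index_vertical s t u v z : s < t -> complex.Re u = complex.Re v ->
  arg_index s t (('X - z%:P) \Po segment s t u v)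
  = sgq (complex.Re (u - z))
    * (sgq (complex.Im (v - z)) - sgq (complex.Im (u - z))) / 2.
Proof.
move=> st uv; rewrite /arg_index; have [-> _] := re_im_segment s t u v z.
have -> : complex.Re ((v - u) / (t - s)%:C) = 0.
  rewrite -fmorphV; case: u v uv => [u1 u2] [v1 v2] /= ->.
  by rewrite mulr0 subr0 subrr mul0r.
rewrite polyC0 mul0r addr0 cauchy_index_polyC_num // !horner_im_poly.
rewrite !horner_comp segment_start segment_end // !hornerE !sgqM.
by rewrite mulrBr.
Qed.

Lemma winding_rect_XsubC z : wind ('X - z%:P)
  = (sgq (x1 - complex.Re z) - sgq (x0 - complex.Re z))
    * (sgq (y1 - complex.Im z) - sgq (y0 - complex.Im z)) / 4.
Proof.
rewrite winding_rectE !big_ord_recl big_ord0 /= /bump /=.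
(* Pieces 0 and 2 are the bottom and top edges. The right and left edges are run in opposite
   directions, which yields the difference of signs in [x]. *)
rewrite [arg_index (quarter R 0) _ _]arg_index_horizontal //.
rewrite [arg_index (quarter R 2) _ _]arg_index_horizontal //.
rewrite !arg_index_vertical ?quarter_incr //.
by case: z => p q /=; field.
Qed.

Lemma winding_rectC u : wind u%:P = 0.
Proof.
rewrite winding_rectE big1 ?mulr0 // => k _; rewrite comp_polyC /arg_index.
have [] := @re_im_polyP u%:P (complex.Re u)%:P (complex.Im u)%:P.
  by move=> j; rewrite !coefC; case: eqP => // _; case: u.
by move=> _ ->; rewrite cauchy_index_polyC_den.
Qed.

Definition root_weight z : rat :=
  (in_interior x0 x1 y0 y1 z)%:R + (in_edge x0 x1 y0 y1 z)%:R / 2.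

Lemma sgq_interval (a b p : R) : a < b ->
  sgq (b - p) - sgq (a - p) = (a < p < b)%R%:R * 2 + ((p == a) || (p == b))%:R.
Proof.
move=> ab; have [pa|pa|->] := ltgtP p a.
- have pb := lt_trans pa ab.
  by rewrite !sgq_gt0 ?subr_gt0 //= (lt_eqF pb) subrr mul0r.
- rewrite (@sgq_lt0 _ (a - p)) ?subr_lt0 //.
  have [pb|pb|->] := ltgtP p b.
  + by rewrite sgq_gt0 ?subr_gt0 //= mul1r addr0 opprK.
  + by rewrite sgq_lt0 ?subr_lt0 //= mul0r addr0 subrr.
  + by rewrite subrr sgq0 sub0r opprK /= ?mul0r ?add0r.
by rewrite subrr sgq0 subr0 sgq_gt0 ?subr_gt0 //= mul0r add0r.
Qed.

(** Each coordinate gives a sign change of 2 inside its range, 1 at an end and 0 outside. A quarter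
    of the product is 1 in the interior and 1/2 on an edge; a vertex would give 1/4. *)
Lemma winding_rect_root z : z \notin rect_vertices x0 x1 y0 y1 ->
  wind ('X - z%:P) = root_weight z.
Proof.
move=> zv; rewrite winding_rect_XsubC !sgq_interval //.
have sep (a b p : R) : ~~ ((a < p < b) && ((p == a) || (p == b))).
  apply/negP => /andP[/andP[ap pb]] /orP[] /eqP e; move: ap pb;
  by rewrite e ltxx.
rewrite /root_weight /in_interior /in_edge.
case: z zv => p q /=; rewrite !inE !eq_complex /= => zv.
have {zv} : ~~ (((p == x0) || (p == x1)) && ((q == y0) || (q == y1))).
  by move: zv; do !case: (_ == _).
(* The four position tests become independent booleans; [sep] and the exclusion of vertices rule out
   the bad combinations. *)
move: (sep x0 x1 p) (sep y0 y1 q).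
move: (x0 < p < x1) (y0 < q < y1) ((p == x0) || _) ((q == y0) || _).
by case; case; case; case => // _ _ _; field.
Qed.

(** Listing roots with repetition absorbs the multiplicities and matches the factorization into
    linear factors. *)
Lemma root_countE F : F != 0 -> root_count x0 x1 y0 y1 F
  = \sum_(z <- sval (closed_field_poly_normal F)) root_weight z.
Proof.
rewrite /root_count /distinct_roots.
case: closed_field_poly_normal => r /= eF F0.
have em z : mup z F = count_mem z r.
  rewrite eF -mul_polyC mupMr ?mup_prod_XsubC // rootC.
  by rewrite lead_coef_eq0.
transitivity (\sum_(z <- r) (in_interior x0 x1 y0 y1 z)%:R * 1
  + \sum_(z <- r) (in_edge x0 x1 y0 y1 z)%:R / 2 : rat).
  rewrite -!sum_undup_count.
  by congr (_ + _); apply: eq_bigr => z _; rewrite em ?mulr1.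
by rewrite -big_split /=; apply: eq_bigr => z _; rewrite mulr1.
Qed.

Lemma winding_rect_prod (r : seq R[i]) :
  {in r, forall z, z \notin rect_vertices x0 x1 y0 y1} ->
  wind (\prod_(z <- r) ('X - z%:P)) = \sum_(z <- r) root_weight z.
Proof.
elim: r => [|z r IH] h; first by rewrite !big_nil winding_rectC.
have vz w : w \in z :: r -> vertex_free ('X - w%:P).
  move=> wr v vv; rewrite hornerXsubC subr_eq0.
  by apply: contraTneq vv => ->; apply: h.
have hr w : w \in r -> w \in z :: r by move=> wr; rewrite inE wr orbT.
rewrite !big_cons winding_rectM.
- by rewrite IH ?winding_rect_root ?h ?mem_head // => w /hr /h.
- by apply: vz; rewrite mem_head.
move=> v vv; rewrite horner_prod prodf_seq_neq0; apply/allP => w /hr wr /=.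
exact: vz.
Qed.

End Rectangle.


End ComplexPolynomials.

Theorem theorem1p5 (R : rcfType) (x0 x1 y0 y1 : R) (hx : x0 < x1) (hy : y0 < y1)
  (F : {poly R[i]}) (hF : forall v, v \in rect_vertices x0 x1 y0 y1 -> F.[v] != 0) :
  winding_rect x0 x1 y0 y1 F = root_count x0 x1 y0 y1 F.
Proof.
have F0 : F != 0.
  by apply: contraNneq (hF _ (mem_head _ _)) => ->; rewrite horner0.
rewrite root_countE //; case: closed_field_poly_normal => r /= eF.
have c0 : lead_coef F != 0 by rewrite lead_coef_eq0.
have hr : {in r, forall z, z \notin rect_vertices x0 x1 y0 y1}.
  move=> z zr; apply/negP => /hF /negP; apply.
  by rewrite -/(root F z) eF rootZ // root_prod_XsubC.
(* The leading coefficient is a constant factor of winding number 0. *)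
rewrite {1}eF -mul_polyC winding_rectM.
- by rewrite winding_rectC add0r winding_rect_prod.
- by move=> v _; rewrite hornerC.
move=> v /hF; apply: contraNN => /eqP e.
by rewrite eF hornerZ e mulr0.
Qed.
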